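(* Let $G$ be a finite abelian group whose exponent $n\geq 2$ is odd, written as $G=H\oplus C_n^r$ with $\exp(H)<n$, and let $A=[1,n-1]=\{1,\ldots,n-1\}$. Let $S$ be a finite sequence over $G$ such that $0$ does not occur in $S$, every term of $S$ has order $n$, and $N_{A,0}(S)=2^{|S|-D_A(G)+1}$. Then $r\leq |S|\leq 2r$, and there is a maximal $A$-weighted zero-sum free subsequence $T=\prod_{i=1}^r g_i$ of $S$ such that $$S=\prod_{i=1}^{r}g_i\prod_{j=1}^{k}h_j,$$ where $k\in[0,r]$ (for $k=0$ this means $S=\prod_{i=1}^r g_i$), and there exist pairwise disjoint subsets $I_1,\ldots,I_k\subseteq[1,r]$ such that for each $j\in[1,k]$ there are $b_j\in A$ and coefficients $a_i^{(j)}\in A$ ($i\in I_j$) with $$b_jh_j=\sum_{i\in I_j}a_i^{(j)}g_i.$$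
   Context: $G$ is written additively; $C_n$ is the cyclic group of order $n$. The decomposition is $G=H\oplus C_n^r$ with $H=C_{n_1}\oplus\cdots\oplus C_{n_t}$ (possibly trivial), $1<n_1\mid n_2\mid\cdots\mid n_t\mid n=\exp(G)$ and $n_t<n$. For integers $a,b\ge 0$, $[a,b]$ denotes the set of non-negative integers $x$ with $a\le x\le b$. A sequence over $G$ is a finite sequence $S=\prod_{i=1}^m g_i$ of elements of $G$ (repetition allowed, order irrelevant); $|S|=m$ is its length. Subsequences are identified by their index sets $I\subseteq[1,m]$. $N_{A,0}(S)$ is the number of index sets $I\subseteq [1,m]$ (including $I=\emptyset$, whose sum is by convention $0$) for which there exist $a_i\in A$ ($i\in I$) with $\sum_{i\in I}a_ig_i=0$. The $A$-weighted Davenport constant $D_A(G)$ is the smallest positive integer $l$ such that for every sequence $g_1\cdots g_t$ over $G$ of length $t\ge l$ there are a nonempty $I\subseteq[1,t]$ and $a_i\in A$ ($i\in I$) with $\sum_{i\in I}a_ig_i=0$. A sequence $g_1\cdots g_m$ is $A$-weighted zero-sum free if there are no nonempty $I\subseteq[1,m]$ and $a_i\in A$ ($i\in I$) with $\sum_{i\in I}a_ig_i=0$. A subsequence $T$ of $S$ is a maximal $A$-weighted zero-sum free subsequence if it is $A$-weighted zero-sum free and has maximal length among the $A$-weighted zero-sum free subsequences of $S$. *)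

(* Defs.v *)
From HB Require Import structures.
From mathcomp Require Import all_boot all_order all_algebra all_fingroup all_solvable.

Set Implicit Arguments.
Unset Strict Implicit.
Unset Printing Implicit Defensive.

Import GRing.Theory Num.Theory.
Local Open Scope ring_scope.

(* A sequence over G is a [seq G], used only up to permutation; its index sets
   are the I : {set 'I_(size S)}.  A weight set A is a set of integers in
   [0, n - 1], encoded as a {set 'I_n}, so that all the existential statements
   about weights are decidable. *)

Section WeightedZeroSums.

Variables (G : finZmodType) (n : nat) (A : {set 'I_n}).
Implicit Types S T : seq G.

Definition weighted_zero_sum S (I : {set 'I_(size S)}) : bool :=
  [exists a : {ffun 'I_(size S) -> 'I_n},
     [forall i in I, a i \in A] && (\sum_(i in I) S`_i *+ a i == 0)].

(* The empty index set is counted. *)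
Definition num_weighted_zero_sums S : nat :=
  #|[set I : {set 'I_(size S)} | weighted_zero_sum I]|.

Definition has_weighted_zero_sum S : bool :=
  [exists I : {set 'I_(size S)}, (I != set0) && weighted_zero_sum I].

Definition weighted_zero_sum_free S : bool := ~~ has_weighted_zero_sum S.

Definition forces_weighted_zero_sum (l : nat) : Prop :=
  forall S, (l <= size S)%N -> has_weighted_zero_sum S.

Definition is_davenport (D : nat) : Prop :=
  [/\ (0 < D)%N, forces_weighted_zero_sum D
    & forall l, (0 < l)%N -> forces_weighted_zero_sum l -> (D <= l)%N].

(* [seq.subseq] preserves the order of the terms, which is irrelevant here. *)
Definition subsequence T S : Prop := exists2 U, subseq U S & perm_eq T U.

Definition maximal_weighted_zero_sum_free S T : Prop :=
  [/\ subsequence T S, weighted_zero_sum_free T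
    & forall U, subsequence U S -> weighted_zero_sum_free U ->
        (size U <= size T)%N].

End WeightedZeroSums.

Definition full_weights (n : nat) : {set 'I_n} := [set a : 'I_n | (0 < a)%N].

(* Main.v *)
(* Choose a prime p with exp(H) | n/p.  Then g |-> (n/p) g maps G onto a copy of
   F_p^r, so a linear relation over F_p between the images of the terms of S is a
   weighted zero-sum relation in G with weights in (n/p)[1, p-1].  This gives
   D_A(G) = r + 1, and shows that the supports of the code of relations are among
   the 2^(|S|-r) weighted zero-sum index sets.  If f picks a row basis with
   complement C, every subset of C is the trace on C of such a support; by
   counting, the basis has r elements and an index set is determined by its trace
   on C.  If two terms outside the basis shared a basis element, the relations
   v1 + t v2 and v1 - t v2 would, for a suitable t <> 0 and p odd, have the same
   trace on C but different supports. *)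
Require Import Defs.
From HB Require Import structures.
From mathcomp Require Import all_boot all_order all_algebra all_fingroup all_solvable.

Set Implicit Arguments.
Unset Strict Implicit.
Unset Printing Implicit Defensive.

Import GRing.Theory Num.Theory FinRing.Theory.
Local Open Scope ring_scope.

(** * Supports of the left kernel of a matrix *)

Section KernelSupports.

Variables (F : fieldType) (m r : nat) (X : 'M[F]_(m, r)).
Variable Fam : {set {set 'I_m}}.
Hypothesis supp_Fam :
  forall c : 'rV_m, c *m X = 0 -> [set i | c 0 i != 0] \in Fam.

(** [u *m X] is the combination of the basis rows with coefficients [u *m W]. Subtracting these,
    spread over [codom f] by [rowsub f 1%:M], turns [u] into a relation and changes it only on the
    basis. *)
Lemma kernel_vector k (f : 'I_k -> 'I_m) (W : 'M_(m, k)) (u : 'rV_m) :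
    injective f -> X = W *m rowsub f X -> (forall i, u 0 (f i) = 0) ->
  exists c : 'rV_m,
    [/\ c *m X = 0, (forall j, j \notin codom f -> c 0 j = u 0 j)
      & forall i, c 0 (f i) = - (u *m W) 0 i].
Proof.
move=> f_inj defX u0; exists (u - u *m W *m rowsub f 1%:M); split.
- by rewrite mulmxBl -!mulmxA mul_rowsub_mx mul1mx -defX subrr.
- move=> j Cj; rewrite !mxE big1 ?subr0 // => i _; rewrite !mxE.
  case: eqP => [fi|]; last by rewrite mulr0.
  by rewrite -fi codom_f in Cj.
- move=> i; move: (u *m W) => w; rewrite !mxE u0 sub0r; congr (- _).
  rewrite (bigD1 i) //= big1 => [|i' ni']; rewrite !mxE ?eqxx ?mulr1 ?addr0 //.
  by rewrite (inj_eq f_inj) (negPf ni') mulr0.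
Qed.

Lemma powerset_codomC_sub k (f : 'I_k -> 'I_m) (W : 'M_(m, k)) :
    injective f -> X = W *m rowsub f X ->
  powerset (~: [set j in codom f]) \subset
    [set I :&: ~: [set j in codom f] | I in Fam].
Proof.
move=> f_inj defX; apply/subsetP=> U; rewrite inE => sUC.
(* The indicator vector of [U] vanishes on the basis and is completed there to a relation. *)
have [|c [c0 cC cf]] := @kernel_vector _ f W (\row_j (j \in U)%:R) f_inj defX.
  move=> i; rewrite mxE; case: (boolP (f i \in U)) => // /(subsetP sUC).
  by rewrite !inE codom_f.
apply/imsetP; exists [set i | c 0 i != 0]; first exact: supp_Fam.
apply/setP=> j; rewrite !inE; have [Cj|nCj] /= := boolP (j \in codom f).
  by rewrite andbF; apply/negP => /(subsetP sUC); rewrite !inE Cj.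
by rewrite cC // mxE andbT; case: (j \in U); rewrite ?eqxx ?oner_eq0.
Qed.

Lemma card_codomC k (f : 'I_k -> 'I_m) :
  injective f -> #|~: [set j in codom f]| = (m - k)%N.
Proof.
by move=> f_inj; rewrite cardsCs setCK card_ord cardsE card_codom // card_ord.
Qed.

Hypothesis card_Fam : (#|Fam| <= 2 ^ (m - r))%N.
Hypothesis two_neq0 : 2%:R != 0 :> F.
Hypothesis r_le_m : (r <= m)%N.

(** A row basis has [\rank X] elements, so there are at least [2 ^ (m - \rank X)] traces; the bound
    on [Fam] then forces [r <= \rank X]. *)
Lemma kernel_supports_row_full : row_full X.
Proof.
have /submxP[W defX] : (X <= rowsub (maxrankfun X) X)%MS by rewrite eq_maxrowsub.
have /subset_leq_card := powerset_codomC_sub (@maxrankfun_inj _ _ _ X) defX.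
rewrite card_powerset card_codomC; last exact: maxrankfun_inj.
move=> /leq_trans/(_ (leq_imset_card _ _))/leq_trans/(_ card_Fam).
rewrite leq_exp2l // => le_mr; rewrite /row_full eqn_leq rank_leq_col.
by rewrite -(leq_sub2lE _ r_le_m).
Qed.

Lemma kernel_supports_structure :
  exists (f : 'I_r -> 'I_m) (W : 'M_(m, r)),
    [/\ injective f, X = W *m rowsub f X,
        forall I, I \in Fam -> {subset I <= codom f} -> I = set0
      & forall j1 j2 i, j1 \notin codom f -> j2 \notin codom f -> j1 != j2 ->
          W j1 i != 0 -> W j2 i = 0].
Proof.
pose f : 'I_r -> 'I_m := fullrankfun kernel_supports_row_full.
have f_inj : injective f by apply: fullrankfun_inj.
have /submxP[W defX] : (X <= rowsub f X)%MS.
  exact/submx_full/fullrowsub_full.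
pose C := ~: [set j in codom f].
(* The trace on C is onto [powerset C], which is at least as large as [Fam]. *)
have injC : {in Fam &, injective (fun I => I :&: C)}.
  apply/imset_injP; rewrite eqn_leq leq_imset_card /=.
  apply: leq_trans card_Fam _; rewrite -(card_codomC f_inj) -card_powerset.
  exact/subset_leq_card/(powerset_codomC_sub f_inj defX).
exists f, W; split=> // [I FamI sIf | j1 j2 i nj1 nj2 nj12 Wj1].
  (* [I] and [set0] both have empty trace on [C], and [set0] is in [Fam] as the support of the zero
     relation. *)
  apply: injC => //.
    suff <- : [set i | (0 : 'rV[F]_m) 0 i != 0] = set0.
      by rewrite supp_Fam ?mul0mx.
    by apply/setP=> i; rewrite !inE mxE eqxx.
  rewrite set0I; apply/setP=> j; rewrite !inE.
  by case: (boolP (j \in I)) => // /sIf ->.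
(* With this [t], the relation completing [u (- t)] vanishes at [f i], whereas the one completing
   [u t] has the value [-2 W j1 i] there. *)
apply/eqP/negPn/negP=> Wj2; pose t := W j1 i / W j2 i.
have t0 : t != 0 by rewrite mulf_neq0 ?invr_eq0.
pose u (l : F) : 'rV_m := delta_mx 0 j1 + l *: delta_mx 0 j2.
have nf j i' : j \notin codom f -> (f i' == j) = false.
  by move=> nj; apply: contraNF nj => /eqP <-; apply: codom_f.
have uf l i' : u l 0 (f i') = 0.
  by rewrite !mxE /= (nf _ _ nj1) (nf _ _ nj2) mulr0 addr0.
have uW l : (u l *m W) 0 i = W j1 i + l * W j2 i.
  by rewrite mulmxDl -scalemxAl -!rowE !mxE.
have supp_u l j : l != 0 -> (u l 0 j != 0) = (j == j1) || (j == j2).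
  move=> l0; rewrite !mxE /=; have [->|] := eqVneq j j1.
    by rewrite (negPf nj12) mulr0 addr0 oner_eq0.
  by rewrite add0r => _; case: (j == j2); rewrite ?mulr1 ?mulr0 ?l0 ?eqxx.
have [c [c0 cC cf]] := kernel_vector f_inj defX (uf (- t)).
have [d [d0 dC df]] := kernel_vector f_inj defX (uf t).
have /setP/(_ (f i)) : [set i | c 0 i != 0] = [set i | d 0 i != 0].
  apply: injC; rewrite ?supp_Fam //; apply/setP=> j; rewrite !inE.
  have [//|nj] := boolP (j \in codom f); first by rewrite !andbF.
  by rewrite cC ?dC // !supp_u ?oppr_eq0.
rewrite !inE cf df !uW mulNr divfK // subrr oppr0 eqxx oppr_eq0.
by rewrite -mulr2n -mulr_natl mulf_neq0.
Qed.

End KernelSupports.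

(** * Additive maps and reduction of the group modulo a prime *)

Lemma additive_of_morphism (U V : finZmodType) (f : {morphism [set: U] >-> V}) :
  exists g : {additive U -> V}, g =1 f.
Proof.
have fB : zmod_morphism f.
  by move=> x y; rewrite -zmodVgE -zmodMgE morphM ?inE // morphV ?inE.
pose g : {additive U -> V} :=
  HB.pack (f : U -> V) (GRing.isZmodMorphism.Build U V f fB).
by exists g.
Qed.

Lemma isog_additive (U V : finZmodType) (K : {group V}) :
  K \isog [set: U] -> exists g : {additive U -> V}, injective g.
Proof.
rewrite isog_sym => /isog_isom[f /isomP[/injmP f_inj _]].
have [g gE] := additive_of_morphism f; exists g => x y.
by rewrite !gE; apply: f_inj; rewrite inE.
Qed.

(** Any prime factor [p] of [n / e] will do, since [n / p] is [(n / e) / p] times [e]. *)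
Lemma prime_codivisor e n : (0 < n)%N -> (e %| n)%N -> (e < n)%N ->
  exists p, [/\ prime p, (p %| n)%N & (e %| n %/ p)%N].
Proof.
move=> n_gt0 /dvdnP[d def_n]; rewrite def_n => lt_en.
have d_gt1 : (1 < d)%N.
  by case: d lt_en {def_n} => [|[|d]] //; rewrite ?mul0n ?mul1n ?ltnn.
exists (pdiv d); rewrite pdiv_prime // dvdn_mulr ?pdiv_dvd //; split=> //.
by rewrite -divn_mulAC ?pdiv_dvd // dvdn_mull.
Qed.

(* The map is the projection onto K = (Z/n)^r reduced mod p; it has the same
   kernel as g |-> (n/p) g. *)
Lemma exists_reduction (G : finZmodType) (n r p : nat) (H K : {group G}) :
    (1 < n)%N -> (H \x K)%g = [set: G] -> K \isog [set: 'rV['Z_n]_r] ->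
    prime p -> (p %| n)%N -> (exponent H %| n %/ p)%N ->
  exists phi : {additive G -> 'rV['F_p]_r},
    forall g, phi g = 0 -> g *+ (n %/ p) = 0.
Proof.
move=> n_gt1 G_eq /isog_isom[f /isomP[/injmP f_inj _]] p_pr p_n expH.
have [nHG _] := dprod_normal2 G_eq; have [_ defG _ _] := dprodP G_eq.
have coK : K \in [complements to H in [set: G]]%g.
  by have [_ _ _ tiHK] := dprodP G_eq; apply/complP.
have inHK g : g \in (H * K)%g by rewrite defG inE.
pose kap g := remgr H K g.
have kapK g : kap g \in K by rewrite mem_remgr.
have kapD g h : kap (g + h) = kap g + kap h.
  by rewrite /kap -!zmodMgE (remgrM coK nHG) ?inE.
pose red (x : 'Z_n) : 'F_p := (x : nat)%:R.
have redD x y : red (x + y) = red x + red y.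
  (* Addition in ['Z_n] is modulo [(Zp_trunc n).+2], which equals [n] as [1 < n]; reducing further
     modulo [p] is compatible because [p] divides [n]. *)
  rewrite /red (_ : nat_of_ord (x + y) = ((x + y) %% n)%N); last first.
    by congr (_ %% _)%N; apply: Zp_cast.
  by rewrite -(Fp_nat_mod p_pr) modn_dvdm // Fp_nat_mod // natrD.
pose phi g : 'rV['F_p]_r := map_mx red (f (kap g)).
have phiD g h : phi (g + h) = phi g + phi h.
  by apply/rowP=> i; rewrite !mxE kapD -zmodMgE morphM // zmodMgE mxE redD.
have phiB : zmod_morphism phi.
  move=> g h; apply/eqP; rewrite eq_sym subr_eq -phiD subrK; exact/eqP.
pose phiA : {additive G -> 'rV['F_p]_r} :=
  HB.pack phi (GRing.isZmodMorphism.Build _ _ phi phiB).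
exists phiA => g /= phi0.
(* The component in [H] is killed by [n / p] through its exponent. Each coordinate of the component
   in [K] is a multiple of [p], so [n / p] times it is a multiple of [n]. *)
rewrite -zmodXgE [g](divgr_eq H K) expgMn; last first.
  exact: (can_inj opprK) (f_equal _ (addrC _ _)).
have/exponentP -> := expH; last by rewrite mem_divgr.
rewrite mul1g; apply: f_inj; [exact/groupX/kapK | exact: group1 |].
rewrite morph1 morphX ?kapK // zmodXgE; apply/rowP=> i; rewrite mulmxnE.
have /rowP/(_ i) := phi0; rewrite !mxE /red => /eqP.
rewrite -(dvdn_pcharf (pchar_Fp p_pr)) => /dvdnP[c def_x].
rewrite -[f _ 0 i]natr_Zp def_x -mulrnA -mulnA (mulnC p) divnK //.
by rewrite mulnC mulrnA pchar_Zp // mul0rn.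
Qed.

Lemma weighted_zero_sum_imset (G : finZmodType) n (A : {set 'I_n}) (S T : seq G)
    (f : 'I_(size T) -> 'I_(size S)) (I : {set 'I_(size T)}) :
    (0 < n)%N -> injective f -> (forall i : 'I_(size T), T`_i = S`_(f i)) ->
  weighted_zero_sum A I -> weighted_zero_sum A (f @: I).
Proof.
move=> n_gt0 f_inj Tf /existsP[a /andP[/forall_inP aA /eqP sum0]].
(* The default weight 0 is taken only off the image of [f], hence never on [f @: I]. *)
pose b j := oapp a (Ordinal n_gt0) [pick i | f i == j].
have bE i : b (f i) = a i.
  by rewrite /b; case: pickP => [i' /eqP/f_inj-> //|/(_ i)]; rewrite eqxx.
apply/existsP; exists [ffun j => b j]; apply/andP; split.
  by apply/forall_inP=> _ /imsetP[i iI ->]; rewrite ffunE bE aA.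
rewrite big_imset /=; last exact: in2W.
rewrite -[X in _ == X]sum0; apply/eqP/eq_bigr => i _.
by rewrite ffunE bE Tf.
Qed.

(** * From relations over F_p to weighted zero-sums in [G] *)

Section Reduction.

Variables (G : finZmodType) (n r p : nat) (phi : {additive G -> 'rV['F_p]_r}).
Hypotheses (n_gt0 : (0 < n)%N) (p_pr : prime p) (p_n : (p %| n)%N).
Hypothesis phi_eq0 : forall g, phi g = 0 -> g *+ (n %/ p) = 0.

Lemma scaled_weight_subproof (x : 'F_p) : (n %/ p * x < n)%N.
Proof.
rewrite -[X in (_ < X)%N](divnK p_n) ltn_pmul2l ?divn_gt0 ?prime_gt0 //.
  by rewrite -[X in (_ < X)%N](Fp_cast p_pr).
exact: dvdn_leq.
Qed.

Definition scaled_weight x : 'I_n := Ordinal (scaled_weight_subproof x).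

Lemma scaled_weight_full x : (scaled_weight x \in full_weights n) = (x != 0).
Proof.
by rewrite inE /= muln_gt0 divn_gt0 (prime_gt0 p_pr, dvdn_leq n_gt0 p_n) ?lt0n.
Qed.

Lemma additive_Fp_scale g (x : 'F_p) : phi (g *+ x) = x *: phi g.
Proof. by rewrite raddfMn -scaler_nat natr_Zp. Qed.

Definition image_matrix (S : seq G) : 'M['F_p]_(size S, r) :=
  \matrix_i phi S`_i.

(** With the weights [(n / p) c_i], the sum is [n / p] times an element that [phi] sends to
    [c *m image_matrix S = 0]. *)
Lemma kernel_weighted_zero_sum S (c : 'rV_(size S)) : c *m image_matrix S = 0 ->
  weighted_zero_sum (full_weights n) [set i | c 0 i != 0].
Proof.
move=> c0; apply/existsP; exists [ffun i => scaled_weight (c 0 i)].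
apply/andP; split.
  by apply/forall_inP=> i; rewrite ffunE scaled_weight_full inE.
under eq_bigr => i _ do rewrite ffunE /= mulnC mulrnA.
rewrite sumrMnl phi_eq0 // raddf_sum.
under eq_bigr => i _ do rewrite additive_Fp_scale.
rewrite -[RHS]c0 mulmx_sum_row [RHS](bigID [in [set i | c 0 i != 0]]) /=.
rewrite [X in _ = _ + X]big1 ?addr0 => [|i].
  by apply: eq_bigr => i _; rewrite rowK.
by rewrite inE negbK => /eqP->; rewrite scale0r.
Qed.

Lemma long_has_weighted_zero_sum : forces_weighted_zero_sum G (full_weights n) r.+1.
Proof.
move=> S lt_rS; have /rowV0Pn[c] : kermx (image_matrix S) != 0.
  by rewrite kermx_eq0 -row_leq_rank -ltnNge (leq_ltn_trans (rank_leq_col _)).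
move=> /sub_kermxP/kernel_weighted_zero_sum c0 nz_c.
apply/existsP; exists [set i | c 0 i != 0]; rewrite c0 andbT.
apply: contraNneq nz_c => c_eq0; apply/eqP/rowP=> i; rewrite mxE.
by have /setP/(_ i) := c_eq0; rewrite !inE => /negbFE/eqP.
Qed.

(** The difference of [S_j] and the sum of the [W j i] times [S_(f i)] is in the kernel of [phi], so
    [n / p] kills it. This yields the relation for each [h_j]. *)
Lemma image_relation S k (f : 'I_k -> 'I_(size S)) (W : 'M_(size S, k))
    (j : 'I_(size S)) :
    image_matrix S = W *m rowsub f (image_matrix S) ->
  S`_j *+ (n %/ p) =
    \sum_(i | W j i != 0) S`_(f i) *+ scaled_weight (W j i).
Proof.
move=> /(congr1 (row j)); rewrite rowK row_mul mulmx_sum_row => defSj.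
apply/eqP; rewrite -subr_eq0.
under eq_bigr => i _ do rewrite /= mulnC mulrnA.
rewrite sumrMnl -mulrnBl phi_eq0 // raddfB raddf_sum defSj.
under [X in _ - X]eq_bigr => i _ do rewrite additive_Fp_scale.
apply/eqP; rewrite subr_eq0 (bigID (fun i => W j i != 0)) /=.
rewrite [X in _ + X]big1 ?addr0 => [|i]; last first.
  by rewrite negbK mxE => /eqP->; rewrite scale0r.
by apply/eqP/eq_bigr => i _; rewrite row_rowsub rowK mxE.
Qed.

End Reduction.

(** * The Davenport constant and the exponent of 2 *)

Lemma exists_weighted_zero_sum_free (G : finZmodType) (n r : nat) (K : {group G}) :
  (1 < n)%N -> K \isog [set: 'rV['Z_n]_r] ->
  exists2 T : seq G, size T = r & weighted_zero_sum_free (full_weights n) T.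
Proof.
move=> n_gt1 /isog_additive[f f_inj].
(* For the unit vectors, the coordinate of a weighted sum at an index in [I] is the weight itself,
   which is nonzero modulo [n]. *)
pose T := [seq f (delta_mx 0 i) | i <- enum 'I_r].
have sizeT : size T = r by rewrite size_map size_enum_ord.
exists T => //; apply/existsPn => I; rewrite negb_and negbK.
have [-> //|[i iI]] := set_0Vmem I; first by rewrite eqxx.
apply/orP; right; apply/existsPn=> a; apply/negP=> /andP[/forall_inP a_gt0].
pose h := cast_ord sizeT.
have TE (j : 'I_(size T)) : T`_j = f (delta_mx 0 (h j)).
  rewrite (nth_map (h j)) ?size_enum_ord -?sizeT //.
  by congr (f (delta_mx 0 _)); apply: val_inj; rewrite /= nth_enum_ord -?sizeT.
under eq_bigr => j _ do rewrite TE -raddfMn.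
rewrite -raddf_sum -(raddf0 f) (inj_eq f_inj) => /eqP/rowP/(_ (h i)).
rewrite summxE (bigD1 i) //= big1 ?addr0 => [|j /andP[_ nji]]; last first.
  rewrite mulmxnE !mxE eqxx (inj_eq (@cast_ord_inj _ _ _)) eq_sym (negPf nji).
  by rewrite mul0rn.
rewrite mulmxnE !mxE !eqxx (Zp_nat _ (a i)) => /(congr1 val).
rewrite /= Zp_cast // modn_small ?ltn_ord // => ai0.
by have := a_gt0 i iI; rewrite inE ai0.
Qed.

Lemma davenport_full_weights (G : finZmodType) (n r D : nat) (T : seq G) :
    size T = r -> weighted_zero_sum_free (full_weights n) T ->
    forces_weighted_zero_sum G (full_weights n) r.+1 ->
  is_davenport G (full_weights n) D -> D = r.+1.
Proof.
move=> sizeT freeT force_r [_ forceD minD]; apply/eqP; rewrite eqn_leq minD //=.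
rewrite ltnNge; apply: contra freeT => le_Dr.
by apply: forceD; rewrite sizeT.
Qed.

Lemma num_weighted_zero_sums_gt0 (G : finZmodType) n (A : {set 'I_n}) (S : seq G) :
  (0 < n)%N -> (0 < num_weighted_zero_sums A S)%N.
Proof.
move=> n_gt0; apply/card_gt0P; exists set0; rewrite inE.
apply/existsP; exists [ffun => Ordinal n_gt0]; rewrite big_set0 eqxx andbT.
by apply/forall_inP=> i; rewrite inE.
Qed.

(** A negative power of 2 is not an integer, so the count alone forces [r <= m]. *)
Lemma natr_eq_exp2_subz (N m r : nat) : (0 < N)%N ->
  N%:R = 2%:R ^ (m%:Z - r%:Z) :> rat -> (r <= m)%N /\ N = (2 ^ (m - r))%N.
Proof.
move=> N_gt0 defN; have [le_rm|lt_mr] := leqP r m.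
  split=> //; apply/eqP; rewrite -(eqr_nat rat) natrX defN.
  by rewrite subzn // -exprnP.
move: defN; rewrite -opprB subzn ?(ltnW lt_mr) // -invr_expz -exprnP => defN.
have : (N * 2 ^ (r - m))%:R = 1%:R :> rat.
  by rewrite natrM defN natrX mulVf // expf_neq0.
move/eqP; rewrite eqr_nat muln_eq1 => /andP[_].
by rewrite -[X in _ == X](expn0 2) eqn_exp2l // subn_eq0 leqNgt lt_mr.
Qed.

(** * Splitting a sequence along an injection of indices *)

Lemma map_nth_enum_ord (T : Type) (x0 : T) (s : seq T) :
  [seq nth x0 s (i : 'I__) | i <- enum 'I_(size s)] = s.
Proof.
by rewrite (map_comp (nth x0 s) val) val_enum_ord map_nth_iota0 // take_size.
Qed.

Section CodomainSplitting.

Variables (G : finZmodType) (S : seq G) (r : nat) (f : 'I_r -> 'I_(size S)).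
Hypothesis f_inj : injective f.

Let C : {set 'I_(size S)} := ~: [set j in codom f].

Lemma perm_split_codom :
  perm_eq S ([seq S`_(f i) | i <- enum 'I_r] ++ [seq S`_(j : 'I__) | j <- enum C]).
Proof.
pose s := fun j : 'I_(size S) => S`_j.
rewrite -[X in perm_eq X](map_nth_enum_ord 0) (map_comp s f) -map_cat.
apply/perm_map/uniq_perm.
- exact: enum_uniq.
- rewrite cat_uniq map_inj_uniq // !enum_uniq andbT /=; apply/hasPn => j.
  by rewrite mem_enum !inE -codomE.
- by move=> j; rewrite mem_cat !mem_enum !inE -codomE orbN.
Qed.

Lemma subsequence_codom : subsequence [seq S`_(f i) | i <- enum 'I_r] S.
Proof.
pose s := fun j : 'I_(size S) => S`_j.
(* [f] need not be increasing, so its image is listed in the order of [S] and compared up to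
   permutation. *)
exists [seq s j | j <- enum [set j in codom f]].
  rewrite -[X in subseq _ X](map_nth_enum_ord 0).
  by apply: map_subseq; rewrite [enum 'I__]enumT; apply: filter_subseq.
rewrite (map_comp s f); apply/perm_map/uniq_perm; rewrite ?enum_uniq //.
  by rewrite map_inj_uniq // enum_uniq.
by move=> j; rewrite mem_enum inE -codomE.
Qed.

Lemma weighted_zero_sum_free_codom n (A : {set 'I_n}) : (0 < n)%N ->
    (forall I, weighted_zero_sum A (I : {set 'I_(size S)}) ->
       {subset I <= codom f} -> I = set0) ->
  weighted_zero_sum_free A [seq S`_(f i) | i <- enum 'I_r].
Proof.
set T := [seq _ | _ <- _] => n_gt0 zs0.
have sizeT : size T = r by rewrite size_map size_enum_ord.
pose g i := f (cast_ord sizeT i).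
have g_inj : injective g by move=> i j /f_inj/cast_ord_inj.
have Tg (i : 'I_(size T)) : T`_i = S`_(g i).
  rewrite (nth_map (cast_ord sizeT i)) ?size_enum_ord -?sizeT //.
  by congr (S`_(f _)); apply: val_inj; rewrite /= nth_enum_ord -?sizeT.
apply/existsPn => I; apply/negP => /andP[/negP nzI zsI]; apply: nzI.
rewrite -(imset_eq0 g); apply/eqP/zs0.
  exact: weighted_zero_sum_imset zsI.
by move=> _ /imsetP[i _ ->]; apply: codom_f.
Qed.

End CodomainSplitting.

Theorem theorem4p2 (G : finZmodType) (n r : nat) (H K : {group G})
    (n_ge2 : (2 <= n)%N) (n_odd : odd n)
    (expG : exponent [set: G] = n)
    (G_eq : (H \x K)%g = [set: G])
    (expH : (exponent H < n)%N)
    (K_eq : K \isog [set: 'rV['Z_n]_r])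
    (D : nat) (hD : is_davenport G (full_weights n) D)
    (S : seq G) (S_neq0 : 0 \notin S)
    (S_order : forall g : G, g \in S -> #[g]%g = n)
    (S_num : (num_weighted_zero_sums (full_weights n) S)%:R
             = 2%:R ^ ((size S)%:Z - D%:Z + 1) :> rat) :
  (r <= size S <= r.*2)%N /\
  exists (T : r.-tuple G) (k : nat) (h : k.-tuple G) (I : 'I_k -> {set 'I_r}),
    [/\ maximal_weighted_zero_sum_free (full_weights n) S T,
        perm_eq S (T ++ h),
        (k <= r)%N,
        (forall j1 j2 : 'I_k, j1 != j2 -> [disjoint I j1 & I j2])
      & forall j : 'I_k,
          exists (b : 'I_n) (a : 'I_r -> 'I_n),
            [/\ b \in full_weights n,
                (forall i, i \in I j -> a i \in full_weights n)
              & tnth h j *+ b = \sum_(i in I j) tnth T i *+ a i]].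
Proof.
have n_gt0 : (0 < n)%N by apply: ltnW.
have e_n : (exponent H %| n)%N by rewrite -expG exponentS ?subsetT.
have [p [p_pr p_n e_q]] := prime_codivisor n_gt0 e_n expH.
have [phi phi0] := exists_reduction n_ge2 G_eq K_eq p_pr p_n e_q.
have two_neq0 : 2%:R != 0 :> 'F_p.
  rewrite -(dvdn_pcharf (pchar_Fp p_pr)) dvdn_prime2 //.
  by apply: contraTneq n_odd => p2; rewrite -dvdn2 -p2 p_n.
have force_r := long_has_weighted_zero_sum n_gt0 p_pr p_n phi0.
have [B sizeB freeB] := exists_weighted_zero_sum_free n_ge2 K_eq.
have defD := davenport_full_weights sizeB freeB force_r hD.
have [le_rm defN] : (r <= size S)%N /\
    num_weighted_zero_sums (full_weights n) S = (2 ^ (size S - r))%N.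
  apply: natr_eq_exp2_subz; first exact: num_weighted_zero_sums_gt0.
  by rewrite S_num defD intS opprD addrA addrAC subrK.
(* Here [Fam] is the family of all weighted zero-sum index sets of [S]. *)
have [f [W [f_inj defX zs0 disjW]]] := kernel_supports_structure
  (fun c c0 => etrans (in_set _ _) (kernel_weighted_zero_sum n_gt0 p_pr p_n phi0 c0))
  (eq_leq defN) two_neq0 le_rm.
have {}zs0 I : weighted_zero_sum (full_weights n) I -> {subset I <= codom f} -> I = set0.
  by move=> zsI; apply: zs0; rewrite inE.
pose C : {set 'I_(size S)} := ~: [set j in codom f].
(* Otherwise (n/p) S_j = 0, although S_j has order n. *)
have W_neq0 j : exists i, W j i != 0.
  apply/existsP; rewrite -[[exists _, _]]negbK negb_exists.
  apply/negP=> /forallP W0; have ordSj : #[S`_j]%g = n by apply/S_order/mem_nth.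
  have := image_relation n_gt0 p_pr p_n phi0 j defX.
  rewrite big_pred0 => [/eqP|i]; last exact/negbTE.
  rewrite -zmodXgE -zmod1gE -order_dvdn ordSj gtnNdvd ?ltn_Pdiv ?prime_gt1 //.
  by rewrite divn_gt0 ?prime_gt0 // dvdn_leq.
pose e : 'I_#|C| -> 'I_(size S) := tnth (enum_tuple C).
have eC j : e j \notin codom f.
  by have := mem_tnth j (enum_tuple C); rewrite mem_enum !inE.
have e_inj : injective e by apply/tuple_uniqP; rewrite enum_uniq.
pose I j := [set i | W (e j) i != 0].
have disjI j1 j2 : j1 != j2 -> [disjoint I j1 & I j2].
  move=> nj12; rewrite -setI_eq0; apply/eqP/setP=> i; rewrite !inE.
  apply/andP=> -[W1]; apply/negP/negPn/eqP.
  by apply: disjW W1; rewrite ?eC ?(inj_eq e_inj).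
have le_Cr : (#|C| <= r)%N.
  (* Choosing one element in each of the disjoint nonempty sets [I j] gives an injection into
     ['I_r]. *)
  have /fin_all_exists[g gW] j : exists i, W (e j) i != 0 by apply: W_neq0.
  rewrite -[X in (X <= _)%N]card_ord -[X in (_ <= X)%N]card_ord.
  apply: (leq_card g) => j1 j2 eq_g; apply/eqP; apply: contraT => nj12.
  have := gW j2; rewrite -eq_g (disjW (e j1)) ?eqxx ?(inj_eq e_inj) //.
split.
  rewrite le_rm -addnn -leq_subLR.
  by move: le_Cr; rewrite /C card_codomC.
exists [tuple S`_(f i) | i < r], #|C|.
exists (map_tuple (fun j : 'I_(size S) => S`_j) (enum_tuple C)), I.
split=> //.
- split; [exact: subsequence_codom | exact: weighted_zero_sum_free_codom |].
  (* A sequence of more than [r] terms is never free, so [r] terms are maximal. *)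
  move=> U _ freeU; rewrite size_tuple leqNgt.
  by apply: contra freeU; apply: force_r.
- exact: perm_split_codom.
(* All the [b_j] are [n / p], the weight attached to 1 in F_p. *)
move=> j; exists (scaled_weight n_gt0 p_pr p_n 1).
exists (fun i => scaled_weight n_gt0 p_pr p_n (W (e j) i)); split.
- by rewrite scaled_weight_full oner_eq0.
- by move=> i; rewrite inE scaled_weight_full.
rewrite tnth_map; have := image_relation n_gt0 p_pr p_n phi0 (e j) defX.
have -> : nat_of_ord (scaled_weight n_gt0 p_pr p_n 1) = (n %/ p)%N.
  by rewrite /= modn_small ?muln1.
move=> ->; apply: eq_big => i; first by rewrite inE.
by rewrite tnth_mktuple.
Qed.
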